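(* Let $\nu^k={\stackrel{*}{\nu}}{}^{k}+\widetilde\nu{}^{k}i$ (a set containing no complex conjugate vectors) be common complex eigenvectors of the matrices $A_j$ corresponding to the eigenvalues $\lambda_k^j={\stackrel{*}{\lambda}}{}_k^j+\widetilde\lambda{}_k^ji$, $j=1,\ldots,m$, $k=1,\ldots,s$, $s\le(m+1)/2$, respectively. Let $\nu^\theta$ be common real eigenvectors of the $A_j$ corresponding to the eigenvalues $\lambda_\theta^j$, $j=1,\ldots,m$, $\theta=s+1,\ldots,m+1-s$. Then the completely solvable system $dx=A(x)\,dt$ has the autonomous first integral $$F\colon x\to\prod_{k=1}^{s}\bigl(P_k(x)\bigr)^{{\stackrel{*}{h}}_k}\exp\bigl(-2\,\widetilde h_k\varphi_k(x)\bigr)\prod_{\theta=s+1}^{m+1-s}\bigl|\nu^\theta x\bigr|^{h_\theta}\quad\text{for all }x\in\mathscr X,$$ where $\mathscr X\subset{\rm D}(F)$ is a domain, $$P_k(x)=({\stackrel{*}{\nu}}{}^kx)^2+(\widetilde\nu{}^kx)^2\ \ (x\in\mathbb R^n),\qquad\varphi_k(x)=\arctan\frac{\widetilde\nu{}^kx}{{\stackrel{*}{\nu}}{}^kx}\ \ (x\in\mathscr X),\qquad k=1,\ldots,s,$$ and ${\stackrel{*}{h}}_k,\widetilde h_k$, $k=1,\ldots,s$, $h_\theta$, $\theta=s+1,\ldots,m+1-s$, is a real nontrivial solution of $$2\sum_{k=1}^s\bigl({\stackrel{*}{\lambda}}{}_k^j\,{\stackrel{*}{h}}_k-\widetilde\lambda{}_k^j\,\widetilde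 h_k\bigr)+\sum_{\theta=s+1}^{m+1-s}\lambda_\theta^jh_\theta=0,\quad j=1,\ldots,m.$$
   Context: Let $x=(x_1,\ldots,x_n)\in\mathbb R^n$, $t=(t_1,\ldots,t_m)\in\mathbb R^m$. Consider the linear autonomous system of equations in total differentials $dx=A(x)\,dt$, where $A(x)=\|a_{ij}(x)\|$ is $n\times m$ with $a_{ij}(x)=\sum_{\xi=1}^na_{ij\xi}x_\xi$, $a_{ij\xi}\in\mathbb R$. Put $\mathfrak p_j(x)=\sum_{i=1}^na_{ij}(x)\partial_{x_i}$, $j=1,\ldots,m$. The system is assumed completely solvable: $[\mathfrak p_j,\mathfrak p_\zeta]=0$ on $\mathbb R^n$ for all $j,\zeta$. Let $A_j$ be the real $n\times n$ matrix whose entry in row $i$ and column $\xi$ is $a_{\xi ji}$ (so the system is $dx=\sum_jA_j^{T}x\,dt_j$); complete solvability is equivalent to $A_jA_\zeta=A_\zeta A_j$ for all $j,\zeta$. For a vector $\nu$, $\nu x=\sum_{i=1}^n\nu_ix_i$. A star over a symbol denotes the real part and a tilde the imaginary part. A continuously differentiable function $F$ on a domain $\mathscr X\subset\mathbb R^n$ is an autonomous first integral if $\mathfrak p_jF=0$ on $\mathscr X$, $j=1,\ldots,m$. ${\rm D}(F)$ denotes the set where $F$ is defined and continuously differentiable. *)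

(* Defs.v *)
From HB Require Import structures.
From mathcomp Require Import all_boot all_order all_algebra.
From mathcomp Require Import complex.
From mathcomp Require Import all_classical all_reals all_analysis.
Set Implicit Arguments.
Unset Strict Implicit.
Unset Printing Implicit Defensive.
Import Order.TTheory GRing.Theory Num.Theory.
Import numFieldNormedType.Exports.
Local Open Scope classical_set_scope.
Local Open Scope ring_scope.

Section VectorFields.
Context {R : realType} {n : nat}.
Implicit Types (p q : 'cV[R]_n -> 'cV[R]_n) (F : 'cV[R]_n -> R)
  (x : 'cV[R]_n) (X : set 'cV[R]_n).

Definition partial (i : 'I_n) F x : R := 'D_(delta_mx i 0) F x.

(* A vector field p is identified with the operator \sum_i p_i(x) d/dx_i. *)
Definition lie_derivative p F x : R := \sum_i p x i 0 * partial i F x.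

(* Coefficients of the commutator of the operators p and q
   (the second-order terms cancel). *)
Definition lie_bracket p q x : 'cV[R]_n :=
  \col_i (lie_derivative p (fun y => q y i 0) x
          - lie_derivative q (fun y => p y i 0) x).

Definition continuously_differentiable_at F x : Prop :=
  (\forall y \near x, differentiable F y) /\
  (forall i, {for x, continuous (partial i F)}).

Definition is_domain X : Prop := [/\ X !=set0, open X & connected X].

End VectorFields.

Section LinearSystem.
Context {R : realType} {n m : nat}.
Variable a : 'I_n -> 'I_m -> 'I_n -> R.

Definition sys_matrix (x : 'cV[R]_n) : 'M[R]_(n, m) :=
  \matrix_(i, j) \sum_xi a i j xi * x xi 0.

Definition sys_field (j : 'I_m) (x : 'cV[R]_n) : 'cV[R]_n :=
  col j (sys_matrix x).

Definition completely_solvable : Prop :=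
  forall j zeta x, lie_bracket (sys_field j) (sys_field zeta) x = 0.

(* Row i, column xi holds a_{xi j i}, so that dx = \sum_j A_j^T x dt_j. *)
Definition coef_matrix (j : 'I_m) : 'M[R]_n := \matrix_(i, xi) a xi j i.

Definition autonomous_first_integral (F : 'cV[R]_n -> R) (X : set 'cV[R]_n) :
    Prop :=
  is_domain X /\
  (forall x, X x -> continuously_differentiable_at F x /\
                    forall j, lie_derivative (sys_field j) F x = 0).

End LinearSystem.

Section Eigenvectors.

(* Column eigenvectors; mathcomp's [eigenvalue] and [eigenspace] are about
   row vectors. *)
Definition is_eigenvector (K : fieldType) (n : nat) (M : 'M[K]_n)
    (l : K) (v : 'cV[K]_n) : Prop :=
  v != 0 /\ M *m v = l *: v.

Context {R : realType} {n : nat}.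

Definition complexify (M : 'M[R]_n) : 'M[R[i]]_n :=
  map_mx (real_complex R) M.

Definition re_vec (v : 'cV[R[i]]_n) : 'cV[R]_n := map_mx (@complex.Re R) v.
Definition im_vec (v : 'cV[R[i]]_n) : 'cV[R]_n := map_mx (@complex.Im R) v.

Definition conj_vec (v : 'cV[R[i]]_n) : 'cV[R[i]]_n := map_mx (@conjc R) v.

Definition linform (v x : 'cV[R]_n) : R := \sum_i v i 0 * x i 0.

End Eigenvectors.

Section FirstIntegral.
Context {R : realType} {n s r : nat}.
Variables (nuC : 'I_s -> 'cV[R[i]]_n) (nuR : 'I_r -> 'cV[R]_n).
Variables (hre him : 'I_s -> R) (h : 'I_r -> R).
Implicit Types x : 'cV[R]_n.

Definition Pk k x : R :=
  linform (re_vec (nuC k)) x ^+ 2 + linform (im_vec (nuC k)) x ^+ 2.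

Definition phi k x : R :=
  atan (linform (im_vec (nuC k)) x / linform (re_vec (nuC k)) x).

Definition first_integral_fun x : R :=
  (\prod_k (Pk k x `^ hre k * expR (- 2 * him k * phi k x)))
  * \prod_theta `|linform (nuR theta) x| `^ h theta.

(* The operations of the library are total (division by 0, negative powers of
   0), so the set where the formula is meaningful is recorded explicitly. *)
Definition first_integral_meaningful x : Prop :=
  (forall k, linform (re_vec (nuC k)) x != 0) /\
  (forall theta, linform (nuR theta) x = 0 -> 0 <= h theta).

Definition D_F : set 'cV[R]_n :=
  [set x | (\forall y \near x, first_integral_meaningful y) /\
           continuously_differentiable_at first_integral_fun x].

End FirstIntegral.

Definition nontrivial_solution {R : realType} {m s r : nat}
    (lamC : 'I_s -> 'I_m -> R[i]) (lamR : 'I_r -> 'I_m -> R)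
    (hre him : 'I_s -> R) (h : 'I_r -> R) : Prop :=
  [\/ (exists k, hre k != 0), (exists k, him k != 0)
    | (exists theta, h theta != 0)] /\
  (forall j, 2 * (\sum_k (complex.Re (lamC k j) * hre k
                          - complex.Im (lamC k j) * him k))
             + \sum_theta lamR theta j * h theta = 0).

(* Main.v *)
Require Import Defs.
From HB Require Import structures.
From mathcomp Require Import all_boot all_order all_algebra.
From mathcomp Require Import complex.
From mathcomp Require Import all_classical all_reals all_analysis.
From mathcomp Require Import ring.
Import Order.TTheory GRing.Theory Num.Theory.
Import numFieldNormedType.Exports.
Local Open Scope classical_set_scope.
Local Open Scope ring_scope.

(** Write p_j for the vector field x |-> A_j^T x.  A common eigenvector nu of the
A_j turns the linear form nu x into an eigenfunction of every p_j:
p_j (nu x) = (A_j nu) x = lambda^j (nu x).  Hence p_j ln |nu x| = lambda^j for a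
real nu, while for a complex nu the real and imaginary parts of nu x scale at
rate Re lambda^j and rotate at rate Im lambda^j, so that p_j ln P = 2 Re lambda^j
and p_j phi = Im lambda^j.  Applying p_j to ln F therefore gives the constant
2 \sum_k (Re lambda_k^j hre_k - Im lambda_k^j him_k) + \sum_t lambda_t^j h_t,
and the linear system imposed on the exponents says exactly that it vanishes.
A nontrivial solution exists because the system has m equations and m + 1
unknowns ([exists_nontrivial_solution]).

The logarithm is available only where no real form nu^t x vanishes, but with
exponents h_t >= 0 the set D(F) may meet these hyperplanes.  There the argument
is by continuity: the regular points, where F = exp (ln F) and the computation
([is_derive_log_first_integral]) applies, accumulate at every point
of D(F) ([exists_off_hyperplanes]), and p_j F is continuous wherever F is continuously
differentiable, hence vanishes on all of D(F) ([lie_derivative_eq0_of_near]). *)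

Set Implicit Arguments.
Unset Strict Implicit.

(** * Logarithmic derivatives along a vector *)

Section ChainRule.
Context {R : realType} {V : normedModType R}.
Implicit Types (f : R -> R) (g a b : V -> R) (x v : V).

(** Differentiating along v is one-variable calculus on the line x + t v; this
gives access to the chain rule on the real line. *)
Lemma is_derive_lineE g x v (d : R) :
  is_derive x v g d <-> is_derive (0 : R) 1 (fun t => g (t *: v + x)) d.
Proof.
have E : (fun t : R => t^-1 *: ((g \o shift x) (t *: v) - g x)) =
         (fun t : R => t^-1 *: (((fun t => g (t *: v + x)) \o shift (0 : R))
                                 (t *: (1 : R)) - g ((0 : R) *: v + x))).
  by apply/funext => t /=; rewrite scale0r add0r addr0 [_ *: (1 : R)]mulr1.
split=> -[]; rewrite /derivable /derive => dg <-.
  by split; rewrite /derivable /derive -?E.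
by split; rewrite /derivable /derive ?E.
Qed.

Lemma is_derive_comp_real f g x v (df dg : R) :
  is_derive (g x) 1 f df -> is_derive x v g dg ->
  is_derive x v (fun z => f (g z)) (df * dg).
Proof.
move=> Hf /is_derive_lineE Hg; apply/is_derive_lineE.
apply: (@is_derive1_comp _ f (fun t => g (t *: v + x))) => //.
by rewrite scale0r add0r.
Qed.

(** The hypotheses say that the derivative of a + i b along v is
(l + i w) (a + i b), so ln |a + i b| grows at rate l and the argument of
a + i b at rate w. *)
Section RotatingPair.
Variables (a b : V -> R) (x v : V) (l w : R).
Hypotheses (ax0 : a x != 0)
  (Ha : is_derive x v a (l * a x - w * b x))
  (Hb : is_derive x v b (w * a x + l * b x)).

Lemma is_derive_ln_sqr_norm :
  is_derive x v (fun z => ln (a z ^+ 2 + b z ^+ 2)) (2 * l).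
Proof.
have p0 : 0 < a x ^+ 2 + b x ^+ 2.
  by rewrite ltr_wpDr ?sqr_ge0// lt_neqAle eq_sym sqrf_eq0 ax0 sqr_ge0.
have Hp : is_derive x v (fun z => a z ^+ 2 + b z ^+ 2) _ :=
  is_deriveD (is_deriveX 2 Ha) (is_deriveX 2 Hb).
apply: (is_derive_eq (is_derive_comp_real (is_derive1_ln p0) Hp)).
rewrite /GRing.scale /=.
by field; rewrite gt_eqF.
Qed.

Lemma is_derive_arg : is_derive x v (fun z => atan (b z / a z)) w.
Proof.
have Hi : is_derive x v (fun z => (a z)^-1) _ :=
  is_derive_comp_real (is_deriveV (f := id) ax0 (is_derive_id (a x) (1 : R))) Ha.
have Hq : is_derive x v (fun z => b z / a z) _ := is_deriveM Hb Hi.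
apply: (is_derive_eq (is_derive_comp_real (is_derive1_atan _) Hq)).
rewrite /GRing.scale /=.
field; rewrite ax0 /= gt_eqF// ltr_wpDr ?sqr_ge0//.
by rewrite lt_neqAle eq_sym sqrf_eq0 ax0 sqr_ge0.
Qed.

End RotatingPair.

(** A real form is a rotating pair with zero imaginary part and zero rate of
rotation. *)
Lemma is_derive_ln_norm a x v (l : R) : a x != 0 ->
  is_derive x v a (l * a x) -> is_derive x v (fun z => ln `|a z|) l.
Proof.
move=> ax0 Ha.
have E : (fun z => ln `|a z|) = (2^-1 \*: fun z => ln (a z ^+ 2 + 0 ^+ 2)).
  apply/funext => z /=; rewrite expr0n addr0 -real_normK ?num_real//.
  have [->|az0] := eqVneq (a z) 0; first by rewrite normr0 expr0n ln0 // scaler0.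
  by rewrite lnXn ?normr_gt0 // /GRing.scale /=; field.
rewrite E.
have Ha' : is_derive x v a (l * a x - 0 * 0) by rewrite mulr0 subr0.
have H0 : is_derive x v (fun=> 0 : R) (0 * a x + l * 0).
  by rewrite mul0r mulr0 addr0; exact: is_derive_cst.
apply: (is_derive_eq (is_deriveZ 2^-1 (is_derive_ln_sqr_norm ax0 Ha' H0))).
by rewrite /GRing.scale /=; field.
Qed.

End ChainRule.

(** * Linear forms and their hyperplanes *)

Section LinForm.
Context {R : realType} {n : nat}.
Implicit Types (nu x v : 'cV[R]_n).

Lemma linformE nu x : linform nu x = (nu^T *m x) 0 0.
Proof. by rewrite mxE; apply: eq_bigr => i _; rewrite mxE. Qed.

Lemma linformDZ nu (t : R) x v :
  linform nu (t *: v + x) = t * linform nu v + linform nu x.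
Proof. by rewrite !linformE mulmxDr -scalemxAr !mxE. Qed.

Lemma continuous_linform nu : continuous (linform nu).
Proof.
apply: continuous_big => [|i _ x]; first exact: add_continuous.
by apply: (cvgMr (FF := nbhs_filter x)); exact: coord_continuous.
Qed.

Lemma is_derive_linform nu x v : is_derive x v (linform nu) (linform nu v).
Proof.
apply/is_derive_lineE.
have -> : (fun t : R => linform nu (t *: v + x)) =
          (fun t => t * linform nu v + linform nu x).
  by apply/funext => t; rewrite linformDZ.
have Ht : is_derive (0 : R) 1 (fun t : R => t * linform nu v + linform nu x) _
  := is_deriveD (is_deriveM (is_derive_id _ _)
                             (is_derive_cst (linform nu v) _ _))
                (is_derive_cst (linform nu x) _ _).
by apply: (is_derive_eq Ht); rewrite /GRing.scale /=; ring.
Qed.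

Lemma linform_self_gt0 nu : nu != 0 -> 0 < linform nu nu.
Proof.
move=> nu0; rewrite lt_neqAle eq_sym sumr_ge0 ?andbT => [|i _]; last first.
  by rewrite -expr2 sqr_ge0.
apply: contraNneq nu0 => /eqP.
rewrite psumr_eq0 => [/allP nu0|i _]; last by rewrite -expr2 sqr_ge0.
apply/eqP/matrixP => i j; rewrite ord1 mxE; apply/eqP.
by have := nu0 i (mem_index_enum i); rewrite mulf_eq0 orbb.
Qed.

Lemma near_off_hyperplane nu x :
  linform nu x != 0 -> \forall y \near x, linform nu y != 0.
Proof.
move=> nux0; have nbh0 : nbhs (linform nu x) [set r : R | r != 0].
  by apply: open_nbhs_nbhs; split=> //; exact: open_neq.
exact: (@continuous_linform nu x _ nbh0).
Qed.

(** Finitely many hyperplanes have a dense complement: they are avoided one at a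
time, and leaving the hyperplane of nu is possible by moving along nu itself,
since nu nu = |nu|^2 > 0.  Openness of the complement keeps the earlier
conditions true during the later moves. *)
Lemma exists_off_hyperplanes (nus : seq 'cV[R]_n) x (U : set 'cV[R]_n) :
  0 \notin nus -> nbhs x U ->
  exists2 y, U y & {in nus, forall nu, linform nu y != 0}.
Proof.
elim: nus x U => [|nu nus IH] x U; first by move=> _ /nbhs_singleton; exists x.
rewrite inE negb_or eq_sym => /andP[nu0 nus0] Ux.
have [y Uy nuy0] : exists2 y, nbhs y U & linform nu y != 0.
  have [nux0|] := eqVneq (linform nu x) 0; last by exists x.
  have line : (fun t : R => t *: nu + x) @ 0^' --> x.
    apply: cvg_within_filter.
    have {2}<- : 0 *: nu + x = x by rewrite scale0r add0r.
    by apply: cvgD; [apply: cvgZr_tmp; exact: cvg_id | exact: cvg_cst].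
  near (0 : R)^' => t.
  exists (t *: nu + x).
    by near: t; exact: (line _ (nbhs_interior Ux)).
  rewrite linformDZ nux0 addr0 mulf_neq0//.
    by near: t; exact: nbhs_dnbhs_neq.
  by rewrite gt_eqF// linform_self_gt0.
have [z [Uz nuz0] nusz] := IH y _ nus0 (filterI Uy (near_off_hyperplane nuy0)).
by exists z => // mu; rewrite inE => /predU1P[->|/nusz].
Unshelve. all: by end_near. Qed.

End LinForm.

(** * Lie derivatives *)

Section LieDerivative.
Context {R : realType} {n : nat}.
Implicit Types (p : 'cV[R]_n -> 'cV[R]_n) (F : 'cV[R]_n -> R) (x : 'cV[R]_n).

Lemma lie_derivativeE p F x :
  differentiable F x -> lie_derivative p F x = 'D_(p x) F x.
Proof.
move=> dF; rewrite /lie_derivative deriveE//.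
rewrite {2}[p x]matrix_sum_delta linear_sum; apply: eq_bigr => i _.
by rewrite big_ord1 linearZ /partial deriveE.
Qed.

(** A Lie derivative is continuous where the field and the partial derivatives
are, so a zero set accumulating at x contains x. *)
Lemma lie_derivative_eq0_of_near p F x :
  (forall i, {for x, continuous (fun y => p y i 0)}) ->
  (forall i, {for x, continuous (partial i F)}) ->
  (forall U, nbhs x U -> exists2 y, U y & lie_derivative p F y = 0) ->
  lie_derivative p F x = 0.
Proof.
move=> cp cF dense0; apply: contrapT => /eqP Lx0.
have cL : {for x, continuous (lie_derivative p F)}.
  apply: (cvg_big _ (nbhs_filter x)) => [|i _]; first exact: add_continuous.
  exact: (cvgM (FF := nbhs_filter x) (cp i) (cF i)).
have nbh0 : nbhs (lie_derivative p F x) [set r : R | r != 0].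
  by apply: open_nbhs_nbhs; split=> //; exact: open_neq.
have [y /= /eqP Ly0 //] := dense0 _ (cL _ nbh0).
Qed.

End LieDerivative.

(** * Eigenvectors as eigenfunctions of the fields of the system *)

Section EigenForms.
Context {R : realType} {n m : nat}.
Variable a : 'I_n -> 'I_m -> 'I_n -> R.
Implicit Types (nu x : 'cV[R]_n) (v : 'cV[R[i]]_n) (M : 'M[R]_n).

(** The coefficient matrix is the transpose of the matrix of the field, so it acts
on the coefficient vectors of linear forms. *)
Lemma linform_sys_field nu j x :
  linform nu (sys_field a j x) = linform (coef_matrix a j *m nu) x.
Proof.
rewrite !linformE trmx_mul -mulmxA; congr ((_ *m _) _ _).
by apply/matrixP => i k; rewrite !mxE ord1; apply: eq_bigr => xi _; rewrite !mxE.
Qed.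

Lemma sys_field_continuous j i : continuous (fun x => sys_field a j x i 0).
Proof.
have -> : (fun x => sys_field a j x i 0) = linform (\col_xi a i j xi).
  by apply/funext => x; rewrite !mxE; apply: eq_bigr => xi _; rewrite mxE.
exact: continuous_linform.
Qed.

Lemma re_complexify_mul M v : re_vec (complexify M *m v) = M *m re_vec v.
Proof.
apply/matrixP => i k; rewrite !mxE raddf_sum; apply: eq_bigr => j _.
by rewrite !mxE; case: (v j k) => ? ? /=; rewrite mul0r subr0.
Qed.

Lemma im_complexify_mul M v : im_vec (complexify M *m v) = M *m im_vec v.
Proof.
apply/matrixP => i k; rewrite !mxE raddf_sum; apply: eq_bigr => j _.
by rewrite !mxE; case: (v j k) => ? ? /=; rewrite mul0r addr0.
Qed.

Lemma linform_eigen nu (l : R) j x :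
  is_eigenvector (coef_matrix a j) l nu ->
  linform nu (sys_field a j x) = l * linform nu x.
Proof.
case=> _ E.
by rewrite linform_sys_field E !linformE linearZ -scalemxAl mxE.
Qed.

Lemma linform_eigen_re v (l : R[i]) j x :
  is_eigenvector (complexify (coef_matrix a j)) l v ->
  linform (re_vec v) (sys_field a j x) =
  complex.Re l * linform (re_vec v) x - complex.Im l * linform (im_vec v) x.
Proof.
case=> _ E.
rewrite linform_sys_field -re_complexify_mul E /linform !mulr_sumr -sumrB.
apply: eq_bigr => i _; rewrite !mxE; case: l (v i 0) {E} => [? ?] [? ?] /=; ring.
Qed.

Lemma linform_eigen_im v (l : R[i]) j x :
  is_eigenvector (complexify (coef_matrix a j)) l v ->
  linform (im_vec v) (sys_field a j x) =
  complex.Im l * linform (re_vec v) x + complex.Re l * linform (im_vec v) x.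
Proof.
case=> _ E.
rewrite linform_sys_field -im_complexify_mul E /linform !mulr_sumr -big_split.
apply: eq_bigr => i _; rewrite !mxE; case: l (v i 0) {E} => [? ?] [? ?] /=; ring.
Qed.

End EigenForms.

(** * The logarithm of the first integral *)

Section LogFirstIntegral.
Context {R : realType} {n s r : nat}.
Variables (nuC : 'I_s -> 'cV[R[i]]_n) (nuR : 'I_r -> 'cV[R]_n).
Variables (hre him : 'I_s -> R) (h : 'I_r -> R).
Implicit Types (x v : 'cV[R]_n).

(** Where a real form nu x vanishes, the convention ln 0 = 0 counts the factor
|nu x|^h as 1, so this is a logarithm of F off these hyperplanes. *)
Definition log_first_integral x : R :=
  (\sum_k (hre k * ln (Pk nuC k x) + (- 2 * him k) * phi nuC k x))
  + \sum_theta h theta * ln `|linform (nuR theta) x|.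

Definition regular_point x : Prop :=
  (forall k, linform (re_vec (nuC k)) x != 0) /\
  (forall theta, linform (nuR theta) x != 0).

Lemma first_integral_fun_expR x : regular_point x ->
  first_integral_fun nuC nuR hre him h x = expR (log_first_integral x).
Proof.
move=> [re0 nu0]; rewrite /log_first_integral expRD !expR_sum; congr (_ * _).
  apply: eq_bigr => k _; rewrite expRD /powR gt_eqF//.
  by rewrite ltr_wpDr ?sqr_ge0// lt_neqAle eq_sym sqrf_eq0 re0 sqr_ge0.
by apply: eq_bigr => t _; rewrite /powR normr_eq0 (negbTE (nu0 t)).
Qed.

Lemma near_regular_point x :
  regular_point x -> \forall y \near x, regular_point y.
Proof.
move=> [re0 nu0]; apply: (@filterI _ _ (nbhs_filter x)).
  by apply: (filter_forall (nbhs_filter x)) => k; exact: near_off_hyperplane.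
by apply: (filter_forall (nbhs_filter x)) => t; exact: near_off_hyperplane.
Qed.

(** The three equations are what the eigenvector equations give when v is the
value at x of a field of the system. *)
Lemma is_derive_log_first_integral x v (lamC : 'I_s -> R[i]) (lamR : 'I_r -> R) :
  regular_point x ->
  (forall k, linform (re_vec (nuC k)) v =
     complex.Re (lamC k) * linform (re_vec (nuC k)) x
     - complex.Im (lamC k) * linform (im_vec (nuC k)) x) ->
  (forall k, linform (im_vec (nuC k)) v =
     complex.Im (lamC k) * linform (re_vec (nuC k)) x
     + complex.Re (lamC k) * linform (im_vec (nuC k)) x) ->
  (forall theta, linform (nuR theta) v = lamR theta * linform (nuR theta) x) ->
  is_derive x v log_first_integral
    (2 * (\sum_k (complex.Re (lamC k) * hre k - complex.Im (lamC k) * him k))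
     + \sum_theta lamR theta * h theta).
Proof.
move=> [re0 nu0] Ere Eim Enu; rewrite mulr_sumr.
have dre k := is_derive_linform (re_vec (nuC k)) x v.
have dim k := is_derive_linform (im_vec (nuC k)) x v.
have dnu t := is_derive_linform (nuR t) x v.
have dC k : is_derive x v
    (fun z => hre k * ln (Pk nuC k z) + (- 2 * him k) * phi nuC k z)
    (2 * (complex.Re (lamC k) * hre k - complex.Im (lamC k) * him k)).
  move: (dre k) (dim k); rewrite Ere Eim => dr di.
  have dC := is_deriveD
    (is_deriveZ (hre k) (is_derive_ln_sqr_norm (re0 k) dr di))
    (is_deriveZ (- 2 * him k) (is_derive_arg (re0 k) dr di)).
  by apply: (is_derive_eq dC); rewrite /GRing.scale /=; ring.
have dR t : is_derive x v
    (fun z => h t * ln `|linform (nuR t) z|) (lamR t * h t).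
  move: (dnu t); rewrite Enu => /(is_derive_ln_norm (nu0 t)) /(is_deriveZ (h t)).
  by rewrite /GRing.scale /= mulrC.
have := is_deriveD (is_derive_sum dC) (is_derive_sum dR).
by rewrite !fct_sumE.
Qed.

Lemma derive_first_integral_fun x v :
  regular_point x -> is_derive x v log_first_integral 0 ->
  'D_v (first_integral_fun nuC nuR hre him h) x = 0.
Proof.
move=> regx dlog.
have dexp := is_derive_comp_real (is_derive_expR (log_first_integral x)) dlog.
have nearE : \forall y \near x,
    expR (log_first_integral y) = first_integral_fun nuC nuR hre him h y.
  by apply: filterS (near_regular_point regx) => y /first_integral_fun_expR.
by rewrite (@derive_val _ _ _ _ _ _ _ (near_eq_is_derive nearE dexp)) mulr0.
Qed.

End LogFirstIntegral.

(** * Existence of exponents *)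

Lemma exists_left_kernel_vector (K : fieldType) (p q : nat) (M : 'M[K]_(p, q)) :
  (q < p)%N -> exists2 u : 'rV[K]_p, u != 0 & u *m M = 0.
Proof.
move=> qp; have ker0 : kermx M != 0.
  by rewrite kermx_eq0 /row_free ltn_eqF// (leq_ltn_trans (rank_leq_col M)).
exists (nz_row (kermx M)); first by rewrite nz_row_eq0.
by apply/eqP; rewrite -sub_kermx nz_row_sub.
Qed.

(** The exponents are the coordinates of a row vector killed by the matrix whose
rows are 2 Re lambda_k, - 2 Im lambda_k and lambda_t, indexed by the fields. *)
Lemma exists_nontrivial_solution (R : realType) (m s r : nat)
    (lamC : 'I_s -> 'I_m -> R[i]) (lamR : 'I_r -> 'I_m -> R) :
  (m < s + s + r)%N ->
  exists hre him h, nontrivial_solution lamC lamR hre him h.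
Proof.
pose M : 'M[R]_(s + s + r, m) := col_mx
  (col_mx (\matrix_(k, j) (2 * complex.Re (lamC k j)))
          (\matrix_(k, j) (- (2 * complex.Im (lamC k j)))))
  (\matrix_(t, j) lamR t j).
move=> /(exists_left_kernel_vector M)[u u0 uM].
rewrite -[u]hsubmxK -[lsubmx u]hsubmxK in u0 uM.
move: u0 uM; set A := lsubmx (lsubmx u); set B := rsubmx (lsubmx u).
set C := rsubmx u; rewrite !mul_row_col => u0 /matrixP uM.
exists (A 0), (B 0), (C 0); split=> [|j].
  have nz q (Z : 'rV[R]_q) : Z != 0 -> exists k, Z 0 k != 0.
    by case/rV0Pn => k; exists k.
  move: u0; rewrite !row_mx_eq0 !negb_and -orbA => /or3P[] /nz Z0.
  - exact: Or31.
  - exact: Or32.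
  - exact: Or33.
move/(_ 0 j): uM; rewrite !mxE => uM; apply: etrans uM; rewrite mulr_sumr.
congr (_ + _).
  rewrite -big_split; apply: eq_bigr => k _; rewrite !mxE /=; ring.
by apply: eq_bigr => t _; rewrite !mxE mulrC.
Qed.
Unset Implicit Arguments.
Set Strict Implicit.

(** * The first integral *)

Theorem theorem2p2 (R : realType) (n m s : nat)
    (a : 'I_n -> 'I_m -> 'I_n -> R)
    (solvable : completely_solvable a)
    (s_le : (s.*2 <= m.+1)%N)
    (nuC : 'I_s -> 'cV[R[i]]_n) (lamC : 'I_s -> 'I_m -> R[i])
    (nuR : 'I_(m.+1 - s.*2) -> 'cV[R]_n)
    (lamR : 'I_(m.+1 - s.*2) -> 'I_m -> R)
    (nuC_complex : forall k, im_vec (nuC k) != 0)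
    (nuC_nonconj : forall k l, nuC k != conj_vec (nuC l))
    (nuC_eigen : forall k j,
      is_eigenvector (complexify (coef_matrix a j)) (lamC k j) (nuC k))
    (nuR_eigen : forall theta j,
      is_eigenvector (coef_matrix a j) (lamR theta j) (nuR theta)) :
  (exists hre him h, nontrivial_solution lamC lamR hre him h) /\
  (forall hre him h, nontrivial_solution lamC lamR hre him h ->
   forall X : set 'cV[R]_n, is_domain X -> X `<=` D_F nuC nuR hre him h ->
     autonomous_first_integral a (first_integral_fun nuC nuR hre him h) X).
Proof.
split.
  by apply: exists_nontrivial_solution; rewrite addnn subnKC.
move=> hre him h [_ hsol] X domX XD; split=> // x /XD [near_meaningful smoothF].
split=> // j; have [near_diff cont_partial] := smoothF.
apply: lie_derivative_eq0_of_near => // [i|U Ux].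
  exact: sys_field_continuous.
(* An index j is at hand, so each nuR theta is an eigenvector and hence nonzero;
   for m = 0 the hypotheses would allow it to be zero. *)
have nuR0 : 0 \notin codom nuR.
  by apply/codomP => -[theta nu0]; case: (nuR_eigen theta j); rewrite -nu0 eqxx.
have [y [[Uy [re0 _]] dFy] nuy] := exists_off_hyperplanes nuR0
  (filterI (filterI Ux near_meaningful) near_diff).
exists y => //; rewrite lie_derivativeE//.
have regy : regular_point nuC nuR y.
  by split=> // theta; apply: nuy; exact: codom_f.
apply: derive_first_integral_fun => //; rewrite -(hsol j).
apply: is_derive_log_first_integral => // [k|k|theta].
- exact: linform_eigen_re.
- exact: linform_eigen_im.
- exact: linform_eigen.
Qed.
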